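(* Let $\Gamma$ be an Abelian group of order $n^2$ where $n\geq 3$ is odd. Then there exists a $\Gamma$-magic square $\mathrm{MS}_{\Gamma}(n)$ of side $n$.
   Context: For an Abelian group $(\Gamma,+)$ of order $n^2$, a $\Gamma$-magic square $\mathrm{MS}_{\Gamma}(n)$ (of side $n$) is an $n\times n$ array whose entries are all the elements of $\Gamma$ (each element appearing exactly once) such that all row sums, all column sums, the sum along the main diagonal and the sum along the backward main diagonal are equal to the same element $\mu\in\Gamma$. *)

(* Defs.v *)
From HB Require Import structures.
From mathcomp Require Import all_boot all_order all_fingroup all_algebra.

Set Implicit Arguments.
Unset Strict Implicit.
Unset Printing Implicit Defensive.

Import GRing.Theory.
Local Open Scope ring_scope.

Definition is_magic_square_with (Gamma : finZmodType) (n : nat)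
    (A : 'M[Gamma]_n) (mu : Gamma) : Prop :=
  [/\ bijective (fun ij : 'I_n * 'I_n => A ij.1 ij.2),
      forall i : 'I_n, \sum_(j < n) A i j = mu,
      forall j : 'I_n, \sum_(i < n) A i j = mu,
      \sum_(i < n) A i i = mu
    & \sum_(i < n) A i (rev_ord i) = mu].

Definition is_magic_square (Gamma : finZmodType) (n : nat)
    (A : 'M[Gamma]_n) : Prop :=
  exists mu : Gamma, is_magic_square_with A mu.

(* Main.v *)
Require Import Defs.
From HB Require Import structures.
From mathcomp Require Import all_boot all_order all_fingroup all_algebra.
From mathcomp Require Import all_solvable zify.

Set Implicit Arguments.
Unset Strict Implicit.
Unset Printing Implicit Defensive.

(** Choose a subgroup [H] of order [n] of [Gamma] and a transversal [S] of [H]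
    with [-S = S]; as [Gamma] has odd order, [S] can be obtained by
    antisymmetrising any choice of coset representatives and halving.  Number
    [S] and [H] by [Z/n] through maps [s] and [h] turning the reflection
    [x |-> 2c - x] about the middle index [c] into negation, and set
    [A i j = s (i + j - c) + h (i - j + c)].  Since 2 is invertible modulo [n],
    [A] is bijective; every line makes [s] (and [h]) either run over all of its
    values, which cancel in pairs, or stay at [s c = 0] (at [h c = 0]). *)

Import GRing.Theory.
Local Open Scope ring_scope.

(** * Subgroups of prescribed order in abelian groups *)

Lemma abelian_subgroup_of_card (gT : finGroupType) (G : {group gT}) (d : nat) :
  abelian G -> (d %| #|G|)%N -> exists2 H : {group gT}, H \subset G & #|H| = d.
Proof.
elim/ltn_ind: d gT G => d IHd gT G abG d_dvd.
have d_gt0 : (0 < d)%N by apply: dvdn_gt0 d_dvd.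
have [d_le1 | d_gt1] := leqP d 1.
  by exists 1%G; rewrite ?sub1G // cards1; lia.
(* Quotient by a subgroup [<[x]>] of prime order [p] dividing [d]; the preimage of a subgroup of
   order [d %/ p] then has order [d]. *)
have p_pr := pdiv_prime d_gt1; set p := pdiv d in p_pr.
have p_dvd : (p %| d)%N := pdiv_dvd d.
have [x Gx ox] := Cauchy p_pr (dvdn_trans p_dvd d_dvd).
have sxG : <[x]>%g \subset G by rewrite cycle_subG.
have nxG : (<[x]> <| G)%g by rewrite -sub_abelian_normal.
have cardq : (#|(G / <[x]>)%g| * p)%N = #|G|.
  by rewrite card_quotient ?normal_norm // mulnC -ox Lagrange.
have [||| Kq sKq cKq] := IHd (d %/ p)%N _ _ (G / <[x]>)%G.
- by rewrite ltn_Pdiv ?prime_gt1.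
- exact: quotient_abelian.
- by rewrite -(dvdn_pmul2r (prime_gt0 p_pr)) cardq divnK.
have [K defK sxK sKG] := inv_quotientS nxG sKq.
exists K => //.
rewrite -(Lagrange sxK) -card_quotient; last first.
  exact: subset_trans sKG (normal_norm nxG).
by rewrite -defK cKq -[#|_|]/(#[x]%g) ox mulnC divnK.
Qed.

(** * Halving in groups of odd order *)

Section OddOrder.

Variable V : finZmodType.
Hypothesis V_odd : odd #|V|.

Lemma finZmod_mulrn_card (x : V) : x *+ #|V| = 0.
Proof. by rewrite -FinRing.zmodXgE -cardsT expg_cardG ?inE. Qed.

(** The factor is an inverse of 2 modulo [#|V|], and [#|V|] annihilates [V]. *)
Definition half (x : V) : V := x *+ #|V|.+1./2.

Lemma half_double (x : V) : half (x + x) = x.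
Proof.
rewrite /half -mulr2n -mulrnA mul2n -[RHS]addr0 -(finZmod_mulrn_card x) -mulrS.
by congr (_ *+ _); lia.
Qed.

Lemma halfD (x y : V) : half (x + y) = half x + half y.
Proof. exact: mulrnDl. Qed.

Lemma halfN (x : V) : half (- x) = - half x.
Proof. exact: mulNrn. Qed.

Lemma double_inj : injective (fun x : V => x + x).
Proof. by move=> x y /(congr1 half); rewrite !half_double. Qed.

Lemma eq_oppr0 (x : V) : x = - x -> x = 0.
Proof. by move=> xN; apply: double_inj; rewrite {1}xN addr0 addNr. Qed.

(** * Transversals closed under negation *)

Section SymmetricTransversal.

Variable H : {set V}.
Hypothesis H0 : 0 \in H.
Hypothesis HB : forall x y, x \in H -> y \in H -> x - y \in H.

Let HN x : x \in H -> - x \in H.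
Proof. by move=> Hx; rewrite -sub0r HB. Qed.

Let HD x y : x \in H -> y \in H -> x + y \in H.
Proof. by move=> Hx Hy; rewrite -[y]opprK HB ?HN. Qed.

(** The default [0] is never reached when [0 \in H], since [x] itself is a candidate. The predicate
    depends on [x] only through its coset, hence so does the pick. *)
Definition coset_choice (x : V) : V := odflt 0 [pick y | y - x \in H].

Lemma coset_choiceP (x : V) : coset_choice x - x \in H.
Proof.
by rewrite /coset_choice; case: pickP => //= /(_ x); rewrite subrr H0.
Qed.

Lemma coset_choice_eq (x y : V) :
  x - y \in H -> coset_choice x = coset_choice y.
Proof.
move=> Hxy; congr odflt; apply: eq_pick => z /=; apply/idP/idP => Hz.
  by rewrite -(subrKA x) HD.
by rewrite -(subrKA y) HD // -opprB HN.
Qed.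

(** The odd part of [coset_choice], so that negating [x] negates the choice. *)
Definition sym_choice (x : V) : V := half (coset_choice x - coset_choice (- x)).

Lemma sym_choiceN (x : V) : sym_choice (- x) = - sym_choice x.
Proof. by rewrite /sym_choice opprK -halfN opprB. Qed.

Lemma sym_choice_eq (x y : V) : x - y \in H -> sym_choice x = sym_choice y.
Proof.
move=> Hxy; rewrite /sym_choice (coset_choice_eq Hxy); congr (half (_ - _)).
by apply: coset_choice_eq; rewrite -opprD HN.
Qed.

Lemma half_in (x : V) : x \in H -> half x \in H.
Proof.
move=> Hx; rewrite /half; elim: _./2 => [|k IHk]; first by rewrite mulr0n.
by rewrite mulrS HD.
Qed.

(** Twice the difference is a difference of two errors of [coset_choice], at [- x] and at [x]. Both
    lie in [H], which is stable under [half]. *)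
Lemma sym_choiceP (x : V) : x - sym_choice x \in H.
Proof.
have -> : x - sym_choice x =
    half ((coset_choice (- x) - - x) - (coset_choice x - x)).
  rewrite -{1}(half_double x) /sym_choice -halfN -halfD; congr half.
  by rewrite opprK !opprB addrACA [x + _]addrC.
by rewrite half_in // HB ?coset_choiceP.
Qed.

Definition sym_transversal : {set V} := [set sym_choice x | x : V].

Lemma sym_choice_id (x : V) : x \in sym_transversal -> sym_choice x = x.
Proof.
case/imsetP=> y _ ->; apply: sym_choice_eq.
by rewrite -opprB HN ?sym_choiceP.
Qed.

Lemma sym_transversalN (x : V) :
  x \in sym_transversal -> - x \in sym_transversal.
Proof. by case/imsetP=> y _ ->; rewrite -sym_choiceN imset_f. Qed.

Lemma sym_transversal_inj (x y a b : V) :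
  x \in sym_transversal -> y \in sym_transversal -> a \in H -> b \in H ->
  x + a = y + b -> x = y /\ a = b.
Proof.
move=> Sx Sy Ha Hb eq_xy.
suff eq_x : x = y by split=> //; apply: (addrI x); rewrite eq_xy eq_x.
rewrite -(sym_choice_id Sx) -(sym_choice_id Sy); apply: sym_choice_eq.
suff -> : x - y = b - a by rewrite HB.
by apply: (addIr (a + y)); rewrite [a + y]addrC addrA subrK eq_xy addrCA subrK addrC.
Qed.

Lemma card_sym_transversal : (#|sym_transversal| * #|H|)%N = #|V|.
Proof.
rewrite -cardsX -cardsT -(card_in_imset (f := fun u : V * V => u.1 + u.2)).
  apply: eq_card => x; rewrite inE; apply/imsetP.
  exists (sym_choice x, x - sym_choice x) => /=; last by rewrite addrC subrK.
  by rewrite !inE /= imset_f //= sym_choiceP.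
move=> [x a] [y b]; rewrite !inE /= => /andP[Sx Ha] /andP[Sy Hb] eq_xy.
by have [-> ->] := sym_transversal_inj Sx Sy Ha Hb eq_xy.
Qed.

End SymmetricTransversal.

(** * Numbering a symmetric set so that reflection becomes negation *)

Lemma symmetric_enum (S : {set V}) (n : nat) :
  #|S| = n -> odd n -> (forall x, x \in S -> - x \in S) ->
  exists s : 'I_n -> V,
    [/\ injective s, forall i, s i \in S & forall i, s (rev_ord i) = - s i].
Proof.
move=> cardS n_odd SN.
have rkN (x : V) : (enum_rank x == enum_rank (- x)) = (x == 0).
  rewrite (inj_eq enum_rank_inj).
  by apply/eqP/eqP => [e | ->]; rewrite ?oppr0 //; apply: eq_oppr0.
(* Comparing ranks selects exactly one element from each pair of distinct opposites in [S]. *)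
pose P := [set x in S | (enum_rank x < enum_rank (- x))%N].
have notPN (x : V) : - x \in P -> x \notin P.
  by rewrite !inE opprK => /andP[_ ltNx]; rewrite negb_and -leqNgt (ltnW ltNx) orbT.
pose l := enum P.
have memN (x : V) : (x \in rev (map -%R l)) = (- x \in P).
  rewrite mem_rev; apply/mapP/idP => [[y ly ->]|PNx].
    by rewrite opprK -mem_enum.
  by exists (- x); rewrite ?mem_enum ?opprK.
(* Reversing this list negates each entry, with [0] in the middle. *)
pose t := l ++ 0 :: rev (map -%R l).
have P0 : 0 \notin P by rewrite inE oppr0 ltnn andbF.
have t_uniq : uniq t.
  rewrite cat_uniq enum_uniq /= memN oppr0 P0 rev_uniq.
  rewrite (map_inj_uniq oppr_inj) enum_uniq mem_enum negb_or P0 /= andbT.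
  by apply/hasPn => x; rewrite memN mem_enum; apply: notPN.
(* Without [0], the set [S] would be the disjoint union of [P] and its negatives, hence of even
   size. *)
have S0 : 0 \in S.
  apply: contraLR n_odd => S0; rewrite -cardS.
  have -> : S = P :|: [set - x | x in P].
    apply/setP => x; rewrite inE; apply/idP/orP => [Sx | ].
      have [||eqx] := ltngtP (enum_rank x) (enum_rank (- x)).
      - by left; rewrite inE Sx.
      - right; apply/imsetP; exists (- x); rewrite ?opprK // inE SN //=.
        by rewrite opprK.
      - by case/negP: S0; rewrite -(eqP (_ : x == 0)) // -rkN; apply/eqP/val_inj.
    case=> [|/imsetP[y + ->]]; rewrite inE => /andP[] //.
    by move=> /SN.
  rewrite cardsU card_imset; last exact: oppr_inj.
  rewrite (_ : _ :&: _ = set0) ?cards0 ?subn0 ?addnn ?odd_double //.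
  apply/setP => x; rewrite in_set0 in_setI; apply/negP => /andP[Px /imsetP[y Py defx]].
  by move: (notPN y); rewrite -defx Py => /(_ Px).
have memt (x : V) : (x \in t) = (x \in S).
  rewrite mem_cat in_cons memN mem_enum !inE opprK.
  have [-> | x_neq0] := eqVneq x 0; first by rewrite S0 orbT.
  have -> : (- x \in S) = (x \in S).
    by apply/idP/idP => /SN; rewrite ?opprK.
  have : val (enum_rank x) != val (enum_rank (- x)).
    by rewrite (inj_eq val_inj) rkN.
  by case: ltngtP; rewrite ?andbT ?andbF ?orbF.
have size_t : size t = n.
  by rewrite -cardS -(card_uniqP t_uniq); apply: eq_card.
have rev_t : rev t = map -%R t.
  rewrite /t rev_cat rev_cons revK map_cat /= oppr0 cat_rcons map_rev.
  by rewrite -map_comp (eq_map (f := -%R \o -%R) (@opprK V)) map_id.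
exists (fun i => t`_i); split.
- move=> i j /eqP; rewrite nth_uniq ?size_t ?ltn_ord //.
  by move/eqP/val_inj.
- by move=> i; rewrite -memt mem_nth ?size_t.
- move=> i; have := nth_rev 0 (s := t) (n := i).
  rewrite size_t => /(_ (ltn_ord i)) <-.
  by rewrite rev_t (nth_map 0) ?size_t.
Qed.

End OddOrder.

(** * The square and its line sums *)

Lemma sum_reflect_odd (V : finZmodType) (n : nat) (s : 'I_n -> V) :
  odd #|V| -> (forall i, s (rev_ord i) = - s i) -> \sum_i s i = 0.
Proof.
move=> V_odd sN; apply: (eq_oppr0 V_odd).
rewrite -sumrN [LHS](reindex_inj rev_ord_inj).
by apply: eq_bigr => i _; apply: sN.
Qed.

Lemma magic_square_of_factorization (V : finZmodType) (n : nat)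
    (s h : 'I_n -> V) :
  odd n -> #|V| = (n ^ 2)%N ->
  (forall i, s (rev_ord i) = - s i) -> (forall i, h (rev_ord i) = - h i) ->
  (forall i j k l, s i + h j = s k + h l -> i = k /\ j = l) ->
  exists A : 'M[V]_n, is_magic_square A.
Proof.
case: n s h => // m s h m_odd cardV sN hN sh_inj.
have V_odd : odd #|V| by rewrite cardV oddX m_odd orbT.
have I_odd : odd #|'I_m.+1| by rewrite card_ord.
(* Since [m] is even, [m./2] is the exact middle, and [m - i] reads [c + c - i] modulo [m.+1]. *)
pose c : 'I_m.+1 := inZp m./2.
have revE i : rev_ord i = c + c - i.
  apply/val_inj; rewrite /= modnDml modnDmr (modn_small (m := m./2)); last by lia.
  rewrite addnn.
  have -> : (m./2.*2 = m)%N by move: m_odd => /=; lia.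
  by rewrite addnBA 1?ltnW // -addnBAC ?leq_ord // modnDr modn_small // ltnS leq_subr.
have fix_c : rev_ord c = c by rewrite revE addrK.
have s0 : s c = 0 by apply: (eq_oppr0 V_odd); rewrite -sN fix_c.
have h0 : h c = 0 by apply: (eq_oppr0 V_odd); rewrite -hN fix_c.
have sum_s (f : 'I_m.+1 -> 'I_m.+1) : injective f -> \sum_i s (f i) = 0.
  by move=> f_inj; rewrite -[RHS](sum_reflect_odd V_odd sN) [RHS](reindex_inj f_inj).
have sum_h (f : 'I_m.+1 -> 'I_m.+1) : injective f -> \sum_i h (f i) = 0.
  by move=> f_inj; rewrite -[RHS](sum_reflect_odd V_odd hN) [RHS](reindex_inj f_inj).
pose A : 'M[V]_m.+1 := \matrix_(i, j) (s (i + j - c) + h (i - j + c)).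
exists A, 0; split.
(* By cardinality, injectivity suffices. Adding [i + j = k + l] and [i - j = k - l] gives
   [i + i = k + k], and doubling is injective modulo an odd number. *)
- apply: inj_card_bij; last by rewrite card_prod card_ord cardV expnS expn1.
  move=> [i j] [k l] /=; rewrite !mxE => /sh_inj[/addIr e1 /addIr e2].
  have eik : i = k.
    apply: (double_inj I_odd); have := congr2 +%R e1 e2.
    by rewrite !addrA ![_ + _ + i]addrAC ![_ + _ + k]addrAC !addrK.
  by move: e1; rewrite eik => /addrI ->.
- move=> i; under eq_bigr do rewrite mxE.
  rewrite big_split /= sum_s ?sum_h ?addr0 // => x y.
    by move/addIr/addrI/oppr_inj.
  by move/addIr/addrI.
- move=> j; under eq_bigr do rewrite mxE.
  rewrite big_split /= sum_s ?sum_h ?addr0 // => x y.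
    by move/addIr/addIr.
  by move/addIr/addIr.
(* On the main diagonal the index of [h] is constantly [c], while that of [s] is [i + i - c]. *)
- under eq_bigr do rewrite mxE subrr add0r h0 addr0.
  by apply: sum_s => x y /addIr/(double_inj I_odd).
(* Here [j = c + c - i]: the index of [s] is constantly [c], and that of [h] is [i + i - c]. *)
- under eq_bigr => i _.
    rewrite mxE revE [i + _]addrC subrK addrK s0 add0r opprB.
    over.
  by apply: sum_h => x y /addIr; rewrite !addrA => /addIr/(double_inj I_odd).
Qed.

Local Close Scope ring_scope.

Theorem theorem5p1 (n : nat) (Gamma : finZmodType)
    (n_ge3 : 3 <= n) (n_odd : odd n) (card_Gamma : #|Gamma| = n ^ 2) :
  exists A : 'M[Gamma]_n, is_magic_square A.
Proof.
have G_odd : odd #|Gamma| by rewrite card_Gamma oddX n_odd orbT.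
have abG : abelian [set: Gamma].
  by apply/centsP => x _ y _; apply: addrC.
have [|H _ cardH] := abelian_subgroup_of_card (d := n) abG.
  by rewrite cardsT card_Gamma dvdn_mulr.
have H0 : 0%R \in (H : {set Gamma}) by apply: (group1 H).
have HB (x y : Gamma) : x \in H -> y \in H -> (x - y)%R \in H.
  by move=> Hx Hy; apply: (groupM Hx); apply: groupVr.
have HN (x : Gamma) : x \in H -> (- x)%R \in H by apply: groupVr.
have cardS : #|sym_transversal (H : {set Gamma})| = n.
  have := card_sym_transversal G_odd H0 HB.
  rewrite cardH card_Gamma expnS expn1 => /eqP.
  by rewrite eqn_pmul2r ?(ltn_trans _ n_ge3) // => /eqP.
have SN := @sym_transversalN Gamma H.
have [s [s_inj sS sN]] := symmetric_enum G_odd cardS n_odd SN.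
have [h [h_inj hH hN]] := symmetric_enum G_odd cardH n_odd HN.
apply: (magic_square_of_factorization n_odd card_Gamma sN hN).
move=> i j k l.
case/(sym_transversal_inj G_odd H0 HB (sS i) (sS k) (hH j) (hH l)).
by move=> /s_inj -> /h_inj ->.
Qed.
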